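(* The semi-discrete (continuous-in-time) discontinuous Galerkin scheme for the Vlasov equation described in the context decays the $L^2$ norm of the distribution function monotonically: for the solution $f_h$ of the scheme (for each species), $$\frac{d}{dt}\sum_j\int_{K_j}f_h^2\,d\mathbf{z}\le 0$$ at all times, the sum being over all phase-space cells.
   Context: Phase space is $K=\Omega\times V$ with configuration space $\Omega\subset\mathbb{R}^3$ and velocity space $V\subset\mathbb{R}^3$ (boxes), points $\mathbf{z}=(\mathbf{x},\mathbf{v})$, and $\nabla_{\mathbf{z}}=(\nabla_{\mathbf{x}},\nabla_{\mathbf{v}})$. $\mathcal{T}$ is a Cartesian mesh of $K$ with finitely many cells $K_j$, each a product of a configuration-space cell and a velocity-space cell. Let $\mathbf{P}^p$ be a fixed finite-dimensional space of polynomials in $\mathbf{z}$ containing the constants (in the intended scheme, the Serendipity space of order $p$), and $\mathcal{V}_h^p=\{v: v|_{K_j}\in\mathbf{P}^p\ \forall K_j\in\mathcal{T}\}$. On a face of a cell, superscript $-$ (resp. $+$) denotes the trace from just inside (resp. just outside) the cell. For a species with charge $q$ and mass $m>0$, the discrete distribution function $f_h(t,\cdot)\in\mathcal{V}_h^p$ is differentiable in $t$ and satisfies, for all cells $K_j$ and all $w\in\mathcal{V}_h^p$, $$\int_{K_j}w\,\partial_t f_h\,d\mathbf{z}+\oint_{\partial K_j}w^-\,\mathbf{n}\cdot\hat{\mathbf{F}}\,dS-\int_{K_j}\nabla_{\mathbf{z}}w\cdot\boldsymbol{\alpha}_hf_h\,d\mathbf{z}=0,$$ where $\boldsymbol{\alpha}_h=\big(\mathbf{v},\tfrac{q}{m}(\mathbf{E}_h+\mathbf{v}\times\mathbf{B}_h)\big)$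 with $\mathbf{E}_h(t,\mathbf{x}),\mathbf{B}_h(t,\mathbf{x})$ the discrete electric and magnetic fields (piecewise polynomial in $\mathbf{x}$ on the induced mesh of $\Omega$, possibly discontinuous across its faces), $\mathbf{n}$ is the outward unit normal of $K_j$, and $\mathbf{n}\cdot\hat{\mathbf{F}}$ is the local Lax–Friedrichs flux $$\mathbf{n}\cdot\hat{\mathbf{F}}=\tfrac12\mathbf{n}\cdot(\boldsymbol{\alpha}_h^+f_h^++\boldsymbol{\alpha}_h^-f_h^-)-\tfrac{\lambda}{2}(f_h^+-f_h^-),\qquad\lambda=\max(|\mathbf{n}\cdot\boldsymbol{\alpha}_h^+|,|\mathbf{n}\cdot\boldsymbol{\alpha}_h^-|).$$ All integrals are evaluated exactly. Boundary conditions: in configuration space, either $\Omega$ is periodic or $f_h$ vanishes on $\partial\Omega\times V$ and the numerical flux is zero there; in velocity space, $f_h$ vanishes on $\Omega\times\partial V$ and the numerical flux is zero there. *)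

(* Defs.v *)
Set Warnings "-notation-overridden,-ambiguous-paths,-notation-incompatible-prefix,-redundant-canonical-projection".
From HB Require Import structures.
From mathcomp Require Import all_boot all_order all_algebra.
(* mpoly's notations clash with those of the analysis library; its canonical
   structures are needed. *)
From mathcomp Require Import -(notations) mpoly.
From mathcomp Require Import all_classical all_reals all_analysis.
Set Implicit Arguments. Unset Strict Implicit. Unset Printing Implicit Defensive.
Import Order.TTheory GRing.Theory Num.Theory.
Import numFieldNormedType.Exports.
Local Open Scope classical_set_scope.
Local Open Scope ring_scope.

(* [inl i] is the configuration axis x_i, [inr i] the velocity axis v_i.
   Vectors of R^6 are functions [dir -> R], vectors of R^3 functions
   ['I_3 -> R]; points are nested pairs, so that the Lebesgue measures on R^2,
   R^3, R^5 and R^6 are the product measures of the library. *)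
Definition dir : finType := ('I_3 + 'I_3)%type.

Definition plane (R : realType) : Type :=
  (measurableTypeR R * measurableTypeR R)%type.
Definition space3 (R : realType) : Type := (plane R * measurableTypeR R)%type.
Definition phase (R : realType) : Type := (space3 R * space3 R)%type.

Section Points.
Variable R : realType.

Definition coord2 (y : plane R) (l : 'I_2) : R := if l == ord0 then y.1 else y.2.

Definition coord3 (x : space3 R) (i : 'I_3) : R :=
  match val i with 0%N => x.1.1 | 1%N => x.1.2 | _ => x.2 end.

Definition mkspace (a : 'I_3 -> R) : space3 R :=
  (a (inord 0), a (inord 1), a (inord 2)).

Definition zcoord (z : phase R) (d : dir) : R :=
  match d with inl i => coord3 z.1 i | inr i => coord3 z.2 i end.

Definition mkphase (a : dir -> R) : phase R :=
  (mkspace (fun i => a (inl i)), mkspace (fun i => a (inr i))).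

(* z + s a *)
Definition move (z : phase R) (s : R) (a : dir -> R) : phase R :=
  mkphase (fun d => zcoord z d + s * a d).

(* the point of R^3 with i-th coordinate c and remaining coordinates y *)
Definition insert3 (i : 'I_3) (c : R) (y : plane R) : space3 R :=
  mkspace (fun k => if unlift i k is Some l then coord2 y l else c).

Definition dot (a b : dir -> R) : R := \sum_d a d * b d.

Definition cross (a b : 'I_3 -> R) (i : 'I_3) : R :=
  a (ordS i) * b (ordS (ordS i)) - a (ordS (ordS i)) * b (ordS i).

Definition axis (d : dir) : dir -> R := fun k => (k == d)%:R.

Definition grad (w : phase R -> R) (z : phase R) : dir -> R :=
  fun d => derive1 (fun s : R => w (move z s (axis d))) 0.

Definition peval3 (p : mpoly.mpoly 3 R) (x : space3 R) : R :=
  mpoly.meval (coord3 x) p.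

Definition peval (p : mpoly.mpoly (3 + 3) R) (z : phase R) : R :=
  mpoly.meval (fun k => zcoord z (fintype.split k)) p.

End Points.

(* On a product measure the canonical structure of sigma-finite measure that
   inference finds is the one reserved for subprobabilities, so sigma-finiteness
   is restated here and attached to the measures below. *)
Lemma prod_sigma_finite d1 d2 (T1 : measurableType d1) (T2 : measurableType d2)
    (R : realType) (m1 : {sigma_finite_measure set T1 -> \bar R})
    (m2 : {sigma_finite_measure set T2 -> \bar R}) :
  sigma_finite setT (m1 \x m2)%E.
Proof.
have /sigma_finiteP[F [TF ndF Foo]] := sigma_finiteT m1.
have /sigma_finiteP[G [TG ndG Goo]] := sigma_finiteT m2.
exists (fun n => F n `*` G n).
  rewrite -setXTT TF TG predeqE => -[x y]; split.
    move=> [/= [n _ Fnx] [k _ Gky]]; exists (maxn n k) => //; split.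
    - by move: x Fnx; exact/subsetPset/ndF/leq_maxl.
    - by move: y Gky; exact/subsetPset/ndG/leq_maxr.
  by move=> [n _ []/= ? ?]; split; exists n.
move=> k; have [? ?] := Foo k; have [? ?] := Goo k.
split; first exact: measurableX.
by rewrite product_measure1E// lte_mul_pinfty// ge0_fin_numE.
Qed.

Section Lebesgue.
Variable R : realType.

Definition leb2 : set (plane R) -> \bar R :=
  (@lebesgue_measure R \x @lebesgue_measure R)%E.
HB.instance Definition _ := Measure.on leb2.
HB.instance Definition _ := @Measure_isSigmaFinite.Build _ _ _
  leb2 (prod_sigma_finite _ _).

Definition leb3 : set (space3 R) -> \bar R := (leb2 \x @lebesgue_measure R)%E.
HB.instance Definition _ := Measure.on leb3.
HB.instance Definition _ := @Measure_isSigmaFinite.Build _ _ _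
  leb3 (prod_sigma_finite _ _).

Definition leb6 : set (phase R) -> \bar R := (leb3 \x leb3)%E.
HB.instance Definition _ := Measure.on leb6.
HB.instance Definition _ := @Measure_isSigmaFinite.Build _ _ _
  leb6 (prod_sigma_finite _ _).

Definition leb23 : set (plane R * space3 R) -> \bar R := (leb2 \x leb3)%E.
HB.instance Definition _ := Measure.on leb23.
HB.instance Definition _ := @Measure_isSigmaFinite.Build _ _ _
  leb23 (prod_sigma_finite _ _).

Definition leb32 : set (space3 R * plane R) -> \bar R := (leb3 \x leb2)%E.
HB.instance Definition _ := Measure.on leb32.
HB.instance Definition _ := @Measure_isSigmaFinite.Build _ _ _
  leb32 (prod_sigma_finite _ _).

End Lebesgue.

(* A Cartesian (rectilinear, possibly nonuniform) mesh: the nodes along axis d are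
   node d 0 < ... < node d (ncell d), and K = Omega x V is the box spanned by the
   extreme nodes. *)
Record mesh (R : realType) := Mesh {
  ncell : dir -> nat;
  node : dir -> nat -> R;
  ncell_gt0 : forall d, (0 < ncell d)%N;
  node_lt : forall d k, (k < ncell d)%N -> node d k < node d k.+1 }.

Section Mesh.
Variables (R : realType) (M : mesh R).

Definition cell : finType := {dffun forall d : dir, 'I_(ncell M d)}.

Implicit Types (j : cell) (d : dir) (b : bool) (z : phase R).

(* Cells and faces are taken relatively open, so that the one-sided limits
   defining the traces exist at every point of a face. *)
Definition in_slab j d (c : R) : Prop := node M d (j d) < c < node M d (j d).+1.

Definition cell_set j : set (phase R) :=
  [set z | forall d, in_slab j d (zcoord z d)].

Definition conf_cell_set j : set (space3 R) :=
  [set x | forall i : 'I_3, in_slab j (inl i) (coord3 x i)].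

(* The face (d, b) of a cell is its upper (b = true) or lower (b = false) face
   orthogonal to axis d. *)
Definition face_pos j d b : R := node M d (j d + b)%N.

Definition face_set j d b : set (phase R) :=
  [set z | zcoord z d = face_pos j d b /\
           forall k, k != d -> in_slab j k (zcoord z k)].

Definition normal d b : dir -> R := fun k => (-1) ^+ (~~ b) * axis R d k.

Definition face_int j d b (g : phase R -> R) : R :=
  match d with
  | inl i =>
      let pt (y : plane R * space3 R) : phase R :=
        (insert3 i (face_pos j d b) y.1, y.2) in
      \int[@leb23 R]_(y in [set y | face_set j d b (pt y)]) g (pt y)
  | inr i =>
      let pt (y : space3 R * plane R) : phase R :=
        (y.1, insert3 i (face_pos j d b) y.2) in
      \int[@leb32 R]_(y in [set y | face_set j d b (pt y)]) g (pt y)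
  end.

Definition on_boundary j d b : bool :=
  if b then (j d).+1 == ncell M d else val (j d) == 0%N.

(* [per] says whether the configuration domain is periodic *)
Definition on_seam (per : bool) j d b : bool :=
  [&& per, (if d is inl _ then true else false) & on_boundary j d b].

Definition on_wall (per : bool) j d b : bool :=
  on_boundary j d b && ~~ on_seam per j d b.

Definition trace_in d b (g : phase R -> R) z : R :=
  lim (g (move z (- s) (normal d b)) @[s --> (0 : R)^'+]).

(* Across a periodic face the outside is reached after a translation by one
   period. *)
Definition trace_out (per : bool) j d b (g : phase R -> R) z : R :=
  let period := if on_seam per j d b then node M d (ncell M d) - node M d 0
                else 0 in
  lim (g (move z (s - period) (normal d b)) @[s --> (0 : R)^'+]).

Definition DGspace (P : set (mpoly.mpoly (3 + 3) R)) : set (phase R -> R) :=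
  [set w | forall j, exists2 p, P p & forall z, cell_set j z -> w z = peval p z].

Definition piecewise_poly (g : space3 R -> R) : Prop :=
  forall j, exists p, forall x, conf_cell_set j x -> g x = peval3 p x.

Definition alpha (q m : R) (E B : space3 R -> 'I_3 -> R) (z : phase R) : dir -> R :=
  fun d => match d with
  | inl i => coord3 z.2 i
  | inr i => q / m * (E z.1 i + cross (coord3 z.2) (B z.1) i)
  end.

(* Local Lax-Friedrichs flux n.F, set to zero on the walls. *)
Definition LF_flux (per : bool) j d b (a : phase R -> dir -> R) (f : phase R -> R)
    z : R :=
  if on_wall per j d b then 0 else
  let n := normal d b in
  let fi := trace_in d b f z in
  let fo := trace_out per j d b f z in
  let na_i := dot n (fun k => trace_in d b (a ^~ k) z) in
  let na_o := dot n (fun k => trace_out per j d b (a ^~ k) z) in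
  let lambda := Num.max `|na_o| `|na_i| in
  2^-1 * (na_o * fo + na_i * fi) - lambda / 2 * (fo - fi).

(* The weak form on cell j, tested with w; df is the time derivative of f. *)
Definition DG_scheme (per : bool) j (a : phase R -> dir -> R)
    (f df w : phase R -> R) : Prop :=
  \int[@leb6 R]_(z in cell_set j) (w z * df z)
  + \sum_(d : dir) \sum_(b : bool)
      face_int j d b (fun z => trace_in d b w z * LF_flux per j d b a f z)
  - \int[@leb6 R]_(z in cell_set j) (dot (grad w z) (a z) * f z) = 0.

Definition vanishes_on_walls (per : bool) (f : phase R -> R) : Prop :=
  forall j d b, on_wall per j d b ->
  forall z, face_set j d b z -> trace_in d b f z = 0.

End Mesh.

Definition finite_dim_subspace (R : realType) (n : nat)
    (P : set (mpoly.mpoly n R)) : Prop :=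
  exists (N : nat) (phi : 'I_N -> mpoly.mpoly n R),
    P = [set p | exists c : 'I_N -> R, p = \sum_i c i *: phi i].

(* Main.v *)
Require Import Defs.
Set Warnings "-notation-overridden,-ambiguous-paths,-notation-incompatible-prefix".
From HB Require Import structures.
From mathcomp Require Import all_boot all_order all_algebra.
From mathcomp Require Import ring.
From mathcomp Require Import -(notations) mpoly.
From mathcomp Require Import all_classical all_reals all_analysis.
From mathcomp Require Import measurable_realfun.
Set Implicit Arguments. Unset Strict Implicit. Unset Printing Implicit Defensive.
Import Order.TTheory GRing.Theory Num.Theory.
Import numFieldNormedType.Exports.
Local Open Scope classical_set_scope.
Local Open Scope ring_scope.

(* Test the scheme with w = f_h.  Each component alpha_d is independent of z_d, so
   on a line parallel to axis d the volume term is the derivative of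
   alpha_d f_h^2 / 2; integrating it line by line leaves face terms only.  With u
   and v the traces of f_h on the two sides of an interior or periodic face, and A
   the common normal component of alpha_h, the two contributions of the face add
   up to the loss |A| (u - v)^2 / 2; on a wall the trace and the flux vanish.  The
   energy is differentiable in time because f_h ranges over a finite-dimensional
   space on each cell, so that it is a fixed linear combination of its values at
   finitely many points of the cell, which are differentiable. *)

(** * Coordinates and lines parallel to the axes *)

Section Coordinates.
Variable R : realType.
Implicit Types (z : phase R) (d k : dir).

(** Displacements along an axis and along a face normal both become instances of this operation, so
    a line parallel to axis [d] is always [c] mapped to [upd z d c]. *)
Definition upd z d (c : R) : phase R :=
  mkphase (fun k => if k == d then c else zcoord z k).

Lemma coord3_mkspace (a : 'I_3 -> R) i : coord3 (mkspace a) i = a i.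
Proof.
by case: i => -[|[|[|//]]] lt_i; rewrite /coord3/=; congr (a _);
  exact/val_inj/inordK.
Qed.

Lemma zcoord_mkphase (a : dir -> R) d : zcoord (mkphase a) d = a d.
Proof. by case: d => i; rewrite /zcoord coord3_mkspace. Qed.

Lemma coord3_inj (x x' : space3 R) : coord3 x =1 coord3 x' -> x = x'.
Proof.
case: x x' => -[x0 x1] x2 [[y0 y1] y2] xy.
have := (xy (@Ordinal 3 0 isT), xy (@Ordinal 3 1 isT), xy (@Ordinal 3 2 isT)).
by rewrite /coord3/= => -[[-> ->] ->].
Qed.

Lemma zcoord_inj z z' : zcoord z =1 zcoord z' -> z = z'.
Proof.
case: z z' => x v [x' v'] zz'; congr pair; apply: coord3_inj => i.
- exact: (zz' (inl i)).
- exact: (zz' (inr i)).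
Qed.

Lemma zcoord_upd z d c k : zcoord (upd z d c) k = if k == d then c else zcoord z k.
Proof. exact: zcoord_mkphase. Qed.

Lemma upd_upd z d c c' : upd (upd z d c) d c' = upd z d c'.
Proof. by apply: zcoord_inj => k; rewrite !zcoord_upd; case: eqP. Qed.

Lemma upd_id z d : upd z d (zcoord z d) = z.
Proof. by apply: zcoord_inj => k; rewrite zcoord_upd; case: eqP => // ->. Qed.

Lemma move_axis z s d : move z s (axis R d) = upd z d (zcoord z d + s).
Proof.
apply: zcoord_inj => k; rewrite zcoord_upd zcoord_mkphase /axis.
by case: eqP => [->|_]; rewrite (mulr0, mulr1) ?addr0.
Qed.

Lemma move_normal z s d b :
  move z s (normal R d b) = upd z d (zcoord z d + (-1) ^+ (~~ b) * s).
Proof.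
apply: zcoord_inj => k; rewrite zcoord_upd zcoord_mkphase /normal /axis.
by case: eqP => [->|_]; rewrite !(mulr0, mulr1) ?addr0// mulrC.
Qed.

Lemma dot_normal d b (a : dir -> R) : dot (normal R d b) a = (-1) ^+ (~~ b) * a d.
Proof.
rewrite /dot (bigD1 d)//= big1 ?addr0 => [|k /negPf kd]; rewrite /normal /axis.
  by rewrite eqxx mulr1.
by rewrite kd mulr0 mul0r.
Qed.

(** The restriction of [p] to the line through [z] parallel to axis [d], with the absolute
    coordinate as variable. All points of the line therefore share one univariate polynomial. *)
Definition line_poly (p : mpoly.mpoly (3 + 3) R) z d : {poly R} :=
  \sum_(m <- mpoly.msupp p) (mpoly.mcoeff m p)%:P *
    \prod_(i < 3 + 3)
      (if fintype.split i == d then 'X else (zcoord z (fintype.split i))%:P)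
        ^+ m i.

Lemma horner_line_poly p z d c : (line_poly p z d).[c] = peval p (upd z d c).
Proof.
rewrite /peval mpoly.mevalE horner_sum; apply: eq_bigr => m _.
rewrite hornerM hornerC horner_prod; congr (_ * _); apply: eq_bigr => i _.
by rewrite horner_exp zcoord_upd; case: ifP => _; rewrite (hornerX, hornerC).
Qed.

Lemma line_poly_upd p z d c : line_poly p (upd z d c) d = line_poly p z d.
Proof.
apply: eq_bigr => m _; congr (_ * _); apply: eq_bigr => i _; congr (_ ^+ _).
by rewrite zcoord_upd; case: ifP => // ->.
Qed.

End Coordinates.

(** * Bounded measurable functions on a set *)

Section Tame.
Context d (Y : measurableType d) (R : realType).
Implicit Types (D : set Y) (g h : Y -> R).

(** Implies integrability on sets of finite measure and, unlike integrability, is stable under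
    products. *)
Definition tame D g := measurable_fun D g /\ exists C, forall y, D y -> `|g y| <= C.

Lemma tame_cst D c : tame D (fun=> c).
Proof. by split; [exact: measurable_cst|exists `|c|]. Qed.

Lemma tameD D g h : tame D g -> tame D h -> tame D (fun y => g y + h y).
Proof.
move=> [mg [C gC]] [mh [C' hC]]; split; first exact: measurable_funD.
exists (C + C') => y Dy; rewrite (le_trans (ler_normD _ _))// lerD//.
  exact: gC.
exact: hC.
Qed.

Lemma tameM D g h : tame D g -> tame D h -> tame D (fun y => g y * h y).
Proof.
move=> [mg [C gC]] [mh [C' hC]]; split; first exact: measurable_funM.
by exists (C * C') => y Dy; rewrite normrM ler_pM ?gC ?hC.
Qed.

Lemma tameN D g : tame D g -> tame D (fun y => - g y).
Proof.
move=> tg; rewrite [X in tame _ X](_ : _ = fun y => -1 * g y); last first.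
  by apply/funext => y; rewrite mulN1r.
by apply: tameM => //; exact: tame_cst.
Qed.

Lemma tameB D g h : tame D g -> tame D h -> tame D (fun y => g y - h y).
Proof. by move=> tg th; apply: tameD => //; exact: tameN. Qed.

Lemma tame_norm D g : tame D g -> tame D (fun y => `|g y|).
Proof.
move=> [mg [C gC]]; split; first exact: measurableT_comp.
by exists C => y Dy; rewrite normr_id gC.
Qed.

Lemma tameX D g n : tame D g -> tame D (fun y => g y ^+ n).
Proof.
move=> tg; elim: n => [|n ih].
  by under eq_fun do rewrite expr0; exact: tame_cst.
by under eq_fun do rewrite exprS; exact: tameM.
Qed.

Lemma tame_sum D (I : Type) (s : seq I) (g : I -> Y -> R) :
  (forall i, tame D (g i)) -> tame D (fun y => \sum_(i <- s) g i y).
Proof.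
move=> tg; elim: s => [|i s ih].
  by under eq_fun do rewrite big_nil; exact: tame_cst.
by under eq_fun do rewrite big_cons; exact: tameD.
Qed.

Lemma tame_prod D (I : Type) (s : seq I) (g : I -> Y -> R) :
  (forall i, tame D (g i)) -> tame D (fun y => \prod_(i <- s) g i y).
Proof.
move=> tg; elim: s => [|i s ih].
  by under eq_fun do rewrite big_nil; exact: tame_cst.
by under eq_fun do rewrite big_cons; exact: tameM.
Qed.

Lemma eq_tame D g h : (forall y, D y -> g y = h y) -> tame D g -> tame D h.
Proof.
move=> gh [mg [C gC]]; split; last by exists C => y Dy; rewrite -gh// gC.
by apply: eq_measurable_fun mg => y; rewrite inE => /gh.
Qed.

Lemma tame_meval D n (p : mpoly.mpoly n R) (v : Y -> 'I_n -> R) :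
  (forall i, tame D (v ^~ i)) -> tame D (fun y => mpoly.meval (v y) p).
Proof.
move=> tv; under eq_fun do rewrite mpoly.mevalE.
apply: tame_sum => m; apply: tameM; first exact: tame_cst.
by apply: tame_prod => i; exact: tameX.
Qed.

Lemma tame_peval D p (h : Y -> phase R) :
  (forall k, tame D (fun y => zcoord (h y) k)) -> tame D (fun y => peval p (h y)).
Proof. by move=> th; exact: tame_meval. Qed.

Lemma tame_integrable (mu : {measure set Y -> \bar R}) D g : measurable D ->
  (mu D < +oo)%E -> tame D g -> mu.-integrable D (EFin \o g).
Proof.
move=> mD muD [mg [C gC]]; apply: measurable_bounded_integrable => //.
exists C; split; first exact: num_real.
by move=> x Cx y Dy; exact: le_trans (gC _ Dy) (ltW Cx).
Qed.

End Tame.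

(** * Fubini's theorem along an axis *)

Section Slicing.
Variable R : realType.
Notation leb := (@lebesgue_measure R).
Local Open Scope ereal_scope.

Lemma insert3E (c : R) (y : plane R) :
  [/\ insert3 (@Ordinal 3 0 isT) c y = (c, y.1, y.2),
      insert3 (@Ordinal 3 1 isT) c y = (y.1, c, y.2) &
      insert3 (@Ordinal 3 2 isT) c y = (y.1, y.2, c)].
Proof.
pose I0 := @Ordinal 3 0 isT; pose I1 := @Ordinal 3 1 isT; pose I2 := @Ordinal 3 2 isT.
have [E0 E1 E2] : [/\ inord 0 = I0, inord 1 = I1 & inord 2 = I2].
  by split; exact/val_inj/inordK.
have ne (h k : 'I_3) (l : 'I_2) : k = lift h l -> unlift h k = Some l.
  by move=> ->; rewrite liftK.
rewrite /insert3 /mkspace E0 E1 E2; split; rewrite ?unlift_none.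
- by rewrite (ne I0 I1 ord0) ?(ne I0 I2 ord_max)//; exact: val_inj.
- by rewrite (ne I1 I0 ord0) ?(ne I1 I2 ord_max)//; exact: val_inj.
- by rewrite (ne I2 I0 ord0) ?(ne I2 I1 ord_max)//; exact: val_inj.
Qed.

Lemma ord3P (P : 'I_3 -> Prop) :
  P (@Ordinal 3 0 isT) -> P (@Ordinal 3 1 isT) -> P (@Ordinal 3 2 isT) ->
  forall i, P i.
Proof.
move=> P0 P1 P2 [[|[|[|//]]] lt_i].
- by rewrite (_ : Ordinal _ = @Ordinal 3 0 isT)//; exact: val_inj.
- by rewrite (_ : Ordinal _ = @Ordinal 3 1 isT)//; exact: val_inj.
- by rewrite (_ : Ordinal _ = @Ordinal 3 2 isT)//; exact: val_inj.
Qed.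

Lemma coord3_insert3 i (c : R) (y : plane R) : coord3 (insert3 i c y) i = c.
Proof. by rewrite coord3_mkspace unlift_none. Qed.

Lemma coord3_insert3_neq i (c c' : R) (y : plane R) k : k != i ->
  coord3 (insert3 i c y) k = coord3 (insert3 i c' y) k.
Proof.
rewrite eq_sym => ki; rewrite !coord3_mkspace.
by have [l _ ->] := unlift_some ki.
Qed.

Lemma measurable_insert3 i :
  measurable_fun setT (fun ys : plane R * measurableTypeR R => insert3 i ys.2 ys.1).
Proof.
elim/ord3P: i.
- under eq_fun do rewrite (let: And3 e _ _ := insert3E _ _ in e).
  apply/measurable_fun_pairP; split => /=.
    apply/measurable_fun_pairP; split => /=; first exact: measurable_snd.
    exact: measurableT_comp measurable_fst measurable_fst.
  exact: measurableT_comp measurable_snd measurable_fst.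
- under eq_fun do rewrite (let: And3 _ e _ := insert3E _ _ in e).
  apply/measurable_fun_pairP; split => /=.
    apply/measurable_fun_pairP; split => /=; last exact: measurable_snd.
    exact: measurableT_comp measurable_fst measurable_fst.
  exact: measurableT_comp measurable_snd measurable_fst.
- under eq_fun do rewrite (let: And3 _ _ e := insert3E _ _ in e).
  apply/measurable_fun_pairP; split => /=; last exact: measurable_snd.
  apply/measurable_fun_pairP; split => /=.
    exact: measurableT_comp measurable_fst measurable_fst.
  exact: measurableT_comp measurable_snd measurable_fst.
Qed.

(** The measure is nested as two coordinates followed by a third, so for the last axis this is plain
    Tonelli; for the other two the order of integration is permuted by exchanging factors on both
    sides. *)
Lemma tonelli_insert3 i (g : space3 R -> \bar R) :
  measurable_fun setT g -> (forall x, 0 <= g x) ->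
  \int[@leb3 R]_x g x = \int[@leb2 R]_y \int[leb]_s g (insert3 i s y).
Proof.
move=> mg g0.
have mgi : measurable_fun setT
    (fun ys : plane R * measurableTypeR R => g (insert3 i ys.2 ys.1)).
  exact: measurableT_comp mg (measurable_insert3 i).
have mG := @measurable_fun_fubini_tonelli_F _ _ _ _ _ leb _ mgi (fun=> g0 _).
have mgs s : measurable_fun setT (fun y : plane R => g (y, s)).
  by apply: measurableT_comp mg _; exact: pair2_measurable.
have G0 y : 0 <= \int[leb]_s g (insert3 i s y) by exact: integral_ge0.
elim/ord3P: i mgi mG G0 => _ mG G0.
- rewrite fubini_tonelli2// [RHS]fubini_tonelli2//.
  apply: eq_integral => s _; rewrite /fubini_G fubini_tonelli2//.
  apply: eq_integral => x _; apply: eq_integral => r _.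
  by have [-> _ _] := insert3E r (x, s).
- rewrite fubini_tonelli2// [RHS]fubini_tonelli2//.
  apply: eq_integral => s _; rewrite /fubini_G fubini_tonelli1//.
  apply: eq_integral => x _; apply: eq_integral => r _.
  by have [_ -> _] := insert3E r (x, s).
- rewrite fubini_tonelli1//.
  apply: eq_integral => -[x1 x2] _; apply: eq_integral => s _.
  by have [_ _ ->] := insert3E s (x1, x2).
Qed.

End Slicing.

(* The phase space is fibred by lines parallel to the axis [d]; the two shapes of
   [face_int] become instances of a single integral over the base. *)
Record fibration (R : realType) (d : dir) := Fibration {
  base_disp : measure_display;
  base : measurableType base_disp;
  base_measure : {sigma_finite_measure set base -> \bar R};
  pt : R -> base -> phase R;
  measurable_pt :
    measurable_fun setT (fun ys : base * measurableTypeR R => pt ys.2 ys.1);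
  zcoord_pt : forall s y, zcoord (pt s y) d = s;
  upd_pt : forall s s' y, upd (pt s y) d s' = pt s' y;
  tonelli_pt : forall g : phase R -> \bar R,
    measurable_fun setT g -> (forall z, (0 <= g z)%E) ->
    (\int[@leb6 R]_z g z =
     \int[base_measure]_y \int[@lebesgue_measure R]_s g (pt s y))%E;
  face_intE : forall (M : mesh R) (j : cell M) b (g : phase R -> R),
    face_int j d b g =
    \int[base_measure]_(y in [set y | face_set j d b (pt (face_pos j d b) y)])
      g (pt (face_pos j d b) y) }.

Arguments pt {R d} f s y.
Arguments base_measure {R d} f.
Arguments measurable_pt {R d} f.
Arguments zcoord_pt {R d} f s y.
Arguments upd_pt {R d} f s s' y.
Arguments tonelli_pt {R d} f g.
Arguments face_intE {R d} f M j b g.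

Lemma upd_of_coord (R : realType) (z z' : phase R) d :
  (forall k, k != d -> zcoord z k = zcoord z' k) -> upd z d (zcoord z' d) = z'.
Proof.
move=> zz'; apply: zcoord_inj => k; rewrite zcoord_upd.
by case: eqP => [->//|/eqP/zz'].
Qed.

Lemma measurable_conf_line (R : realType) i :
  measurable_fun setT (fun ys : (plane R * space3 R) * measurableTypeR R =>
    (insert3 i ys.2 ys.1.1, ys.1.2)).
Proof.
apply/measurable_fun_pairP; split => /=; last first.
  exact: measurableT_comp measurable_snd measurable_fst.
apply: (measurableT_comp (g := fun ys => (ys.1.1, ys.2)) (measurable_insert3 i)).
apply/measurable_fun_pairP; split => /=; last exact: measurable_snd.
exact: measurableT_comp measurable_fst measurable_fst.
Qed.

Lemma measurable_vel_line (R : realType) i :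
  measurable_fun setT (fun ys : (space3 R * plane R) * measurableTypeR R =>
    (ys.1.1, insert3 i ys.2 ys.1.2)).
Proof.
apply/measurable_fun_pairP; split => /=.
  exact: measurableT_comp measurable_fst measurable_fst.
apply: (measurableT_comp (g := fun ys => (ys.1.2, ys.2)) (measurable_insert3 i)).
apply/measurable_fun_pairP; split => /=; last exact: measurable_snd.
exact: measurableT_comp measurable_snd measurable_fst.
Qed.

(** With the velocity as outer variable on both sides, Tonelli reduces to the three-dimensional case
    at each fixed velocity. The point map is the one inside [face_int], so the clause on face
    integrals holds by conversion. *)
Definition conf_fibration (R : realType) (i : 'I_3) : fibration R (inl i).
Proof.
apply: (@Fibration R (inl i) _ _ (@leb23 R)
  (fun s y => (insert3 i s y.1, y.2))) => //.
- exact: measurable_conf_line.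
- by move=> s y; exact: coord3_insert3.
- move=> s s' y.
  rewrite -[X in upd _ _ X](coord3_insert3 i s' y.1).
  apply: (@upd_of_coord _ _ (insert3 i s' y.1, y.2)) => -[] k // ki.
  exact: coord3_insert3_neq.
- move=> g mg g0.
  have mgi := measurableT_comp mg (@measurable_conf_line R i).
  have mG := @measurable_fun_fubini_tonelli_F _ _ _ _ _
    (@lebesgue_measure R) _ mgi (fun=> g0 _).
  have G0 (y : plane R * space3 R) :
      (0 <= \int[@lebesgue_measure R]_s g (insert3 i s y.1, y.2))%E.
    exact: integral_ge0.
  rewrite fubini_tonelli2// [RHS]fubini_tonelli2//.
  apply: eq_integral => v _; rewrite /fubini_G (@tonelli_insert3 _ i)//.
  exact: measurableT_comp mg (pair2_measurable v).
Defined.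

Definition vel_fibration (R : realType) (i : 'I_3) : fibration R (inr i).
Proof.
apply: (@Fibration R (inr i) _ _ (@leb32 R)
  (fun s y => (y.1, insert3 i s y.2))) => //.
- exact: measurable_vel_line.
- by move=> s y; exact: coord3_insert3.
- move=> s s' y.
  rewrite -[X in upd _ _ X](coord3_insert3 i s' y.2).
  apply: (@upd_of_coord _ _ (y.1, insert3 i s' y.2)) => -[] k // ki.
  exact: coord3_insert3_neq.
- move=> g mg g0.
  have mgi := measurableT_comp mg (@measurable_vel_line R i).
  have mG := @measurable_fun_fubini_tonelli_F _ _ _ _ _
    (@lebesgue_measure R) _ mgi (fun=> g0 _).
  have G0 (y : space3 R * plane R) :
      (0 <= \int[@lebesgue_measure R]_s g (y.1, insert3 i s y.2))%E.
    exact: integral_ge0.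
  rewrite fubini_tonelli1// [RHS]fubini_tonelli1//.
  apply: eq_integral => x _; rewrite /fubini_F (@tonelli_insert3 _ i)//.
  exact: measurableT_comp mg (pair1_measurable x).
Defined.

Definition axis_fibration (R : realType) (d : dir) : fibration R d :=
  match d with inl i => conf_fibration R i | inr i => vel_fibration R i end.

Section FibreIntegrals.
Variables (R : realType) (d : dir) (F : fibration R d).
Local Notation nu := (base_measure F).
Local Notation leb := (@lebesgue_measure R).
Local Open Scope ereal_scope.

Let Phi (ys : base F * measurableTypeR R) := pt F ys.2 ys.1.

Let mPhi : measurable_fun setT Phi. Proof. exact: measurable_pt. Qed.

Let measurable_Phi A : measurable A -> measurable (Phi @^-1` A).
Proof. by move=> mA; rewrite -[_ @^-1` _]setTI; exact: mPhi. Qed.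

(** The Tonelli clause applied to an indicator function. Having an equality of measures lets
    integrals of signed functions be transferred as well. *)
Lemma leb6_pushforward (A : set (phase R)) : measurable A ->
  leb6 A = pushforward (nu \x leb) Phi A.
Proof.
move=> mA; have mPA := measurable_Phi mA.
have mind : measurable_fun setT (fun ys => (\1_(Phi @^-1` A) ys : R)%:E).
  by apply/measurable_EFinP; exact: measurable_indic.
have mindA : measurable_fun setT (fun z => (\1_A z : R)%:E).
  by apply/measurable_EFinP; exact: measurable_indic.
transitivity (\int[@leb6 R]_z (\1_A z)%:E).
  have := @integral_indic _ _ _ (@leb6 R) _ measurableT A mA.
  by rewrite setIT => ->.
transitivity (\int[nu \x leb]_ys (\1_(Phi @^-1` A) ys)%:E).
  rewrite (tonelli_pt F)//.
  by rewrite [RHS]fubini_tonelli1.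
have := @integral_indic _ _ _ (nu \x leb) _ measurableT _ mPA.
by rewrite setIT.
Qed.

(** Change of variables along the pushforward, then Fubini on the product of the base with the line;
    restricting [g] by zero outside [D] avoids describing the slices of [D]. *)
Lemma fibre_integral (D : set (phase R)) (g : phase R -> \bar R) :
  measurable D -> (@leb6 R).-integrable D g ->
  \int[@leb6 R]_(z in D) g z = \int[nu]_y \int[leb]_s (g \_ D) (pt F s y).
Proof.
move=> mD ig; rewrite integral_mkcond.
have {}ig : (@leb6 R).-integrable setT (g \_ D) by rewrite -integrable_mkcond.
set h := g \_ D in ig *.
have mh := measurable_int _ ig.
have eqm (k : phase R -> \bar R) :
    \int[@leb6 R]_z k z = \int[pushforward (nu \x leb) Phi]_z k z.
  by apply: eq_measure_integral => A mA _; exact: leb6_pushforward.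
have ih : (nu \x leb).-integrable setT (h \o Phi).
  apply/integrableP; split; first exact: measurableT_comp mPhi.
  have /integrableP[_] := ig; rewrite eqm ge0_integral_pushforward//.
  exact: measurableT_comp.
by rewrite eqm integral_pushforward// -integral12_prod_meas1.
Qed.

End FibreIntegrals.

(** * Cells and their faces *)

Section Cells.
Variables (R : realType) (M : mesh R).
Implicit Types (j : cell M) (d k : dir).
Notation leb := (@lebesgue_measure R).

Lemma measurable_coord3 i : measurable_fun setT (fun x : space3 R => coord3 x i).
Proof.
elim/ord3P: i; rewrite /coord3/=; last exact: measurable_snd.
  exact: measurableT_comp measurable_fst measurable_fst.
exact: measurableT_comp measurable_snd measurable_fst.
Qed.

Lemma measurable_zcoord k : measurable_fun setT (fun z : phase R => zcoord z k).
Proof.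
case: k => i /=.
  exact: measurableT_comp (measurable_coord3 i) measurable_fst.
exact: measurableT_comp (measurable_coord3 i) measurable_snd.
Qed.

Lemma in_slabE j d :
  [set c | in_slab j d c] = `]node M d (j d), node M d (j d).+1[%classic.
Proof. by apply/seteqP; split => c; rewrite /in_slab /= in_itv. Qed.

Lemma measurable_cell j : measurable (cell_set j).
Proof.
rewrite (_ : cell_set j =
    \bigcap_(d in [set: dir]) ((zcoord (R := R))^~ d @^-1` [set c | in_slab j d c])).
  apply: fin_bigcap_measurable => // d _; rewrite -[_ @^-1` _]setTI.
  by apply: measurable_zcoord => //; rewrite in_slabE.
by apply/seteqP; split => z hz d; [move=> _|]; exact: hz.
Qed.

Lemma leb3_box_lty (I : 'I_3 -> set (measurableTypeR R)) :
  (forall i, measurable (I i)) -> (forall i, (leb (I i) < +oo)%E) ->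
  measurable [set x : space3 R | forall i, I i (coord3 x i)] /\
  (leb3 [set x : space3 R | forall i, I i (coord3 x i)] < +oo)%E.
Proof.
pose i0 := @Ordinal 3 0 isT; pose i1 := @Ordinal 3 1 isT; pose i2 := @Ordinal 3 2 isT.
move=> mI Ioo; rewrite (_ : mkset _ = (I i0 `*` I i1) `*` I i2); last first.
  apply/seteqP; split => [x Ix|[[x0 x1] x2] [[I0 I1] I2]].
    by split; [split|]; [have := Ix i0|have := Ix i1|have := Ix i2].
  by elim/ord3P.
split; first by apply: measurableX => //; exact: measurableX.
rewrite [ltLHS]product_measure1E//; last exact: measurableX.
rewrite [X in (X * _)%E]product_measure1E//.
have I01 : (leb (I i0) * leb (I i1) < +oo)%E.
  by apply: lte_mul_pinfty => //; rewrite ge0_fin_numE.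
apply: lte_mul_pinfty; [exact: mule_ge0| |exact: Ioo].
by rewrite ge0_fin_numE// mule_ge0.
Qed.

Lemma leb6_cell_lty j : (leb6 (cell_set j) < +oo)%E.
Proof.
have slab d : measurable [set c | in_slab j d c] /\
    (leb [set c | in_slab j d c] < +oo)%E.
  rewrite in_slabE; split; first exact: measurable_itv.
  by rewrite lebesgue_measure_itv/=; case: ifP => // _; rewrite -EFinB ltry.
have [mX Xoo] := leb3_box_lty (fun i => (slab (inl i)).1) (fun i => (slab (inl i)).2).
have [mY Yoo] := leb3_box_lty (fun i => (slab (inr i)).1) (fun i => (slab (inr i)).2).
rewrite (_ : cell_set j =
  [set x | forall i, [set c | in_slab j (inl i) c] (coord3 x i)] `*`
  [set v | forall i, [set c | in_slab j (inr i) c] (coord3 v i)]).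
  rewrite [ltLHS]product_measure1E//.
  apply: lte_mul_pinfty; [exact: measure_ge0| |exact: Yoo].
  by rewrite ge0_fin_numE; [exact: Xoo|exact: measure_ge0].
apply/seteqP; split => [z hz|z [hx hv]].
  by split => i; [exact: (hz (inl i))|exact: (hz (inr i))].
by move=> [i|i]; [exact: hx|exact: hv].
Qed.

Lemma in_slab_bound j d c : in_slab j d c ->
  `|c| <= `|node M d (j d)| + `|node M d (j d).+1|.
Proof.
move=> /andP[ac cb]; rewrite ler_norml; apply/andP; split.
  rewrite (le_trans _ (ltW ac))// lerNl (le_trans (ler_norm _))// normrN.
  by rewrite lerDl.
by rewrite (le_trans (ltW cb))// (le_trans (ler_norm _))// lerDr.
Qed.

Lemma tame_slab dY (Y : measurableType dY) (D : set Y) (c : Y -> R) j d :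
  measurable_fun setT c -> (forall y, D y -> in_slab j d (c y)) -> tame D c.
Proof.
move=> mc Dc; split; first exact: measurable_funTS.
by eexists => y /Dc /in_slab_bound; exact.
Qed.

Lemma node_lt_cell j d : node M d (j d) < node M d (j d).+1.
Proof. exact/node_lt/ltn_ord. Qed.

Section Base.
Variables (d : dir) (F : fibration R d).
Notation nu := (base_measure F).

(** The base points whose line crosses the cell. The parameter 0 is arbitrary, since the tested
    coordinates are constant along a line; the same set parametrizes both faces orthogonal to
    [d]. *)
Definition base_set j : set (base F) :=
  [set y | forall k, k != d -> in_slab j k (zcoord (pt F 0 y) k)].

Lemma zcoord_pt_neq s s' y k : k != d -> zcoord (pt F s y) k = zcoord (pt F s' y) k.
Proof. by move=> /negPf kd; rewrite -(upd_pt F s s') zcoord_upd kd. Qed.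

Lemma cell_pt j s y : cell_set j (pt F s y) <-> base_set j y /\ in_slab j d s.
Proof.
split=> [h|[hy hs] k].
  split; last by have := h d; rewrite zcoord_pt.
  by move=> k kd; rewrite (zcoord_pt_neq _ s)//; exact: h.
have [->|kd] := eqVneq k d; first by rewrite zcoord_pt.
by rewrite (zcoord_pt_neq _ 0)//; exact: hy.
Qed.

Lemma face_base j b :
  [set y | face_set j d b (pt F (face_pos j d b) y)] = base_set j.
Proof.
apply/seteqP; split => y.
  by move=> [_ hy] k kd; rewrite (zcoord_pt_neq _ (face_pos j d b))//; exact: hy.
move=> hy; split; first by rewrite zcoord_pt.
by move=> k kd; rewrite (zcoord_pt_neq _ 0)//; exact: hy.
Qed.

Lemma face_int_base j b g :
  face_int j d b g = \int[nu]_(y in base_set j) g (pt F (face_pos j d b) y).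
Proof. by rewrite (face_intE F) face_base. Qed.

Lemma measurable_pt_at s : measurable_fun setT (pt F s).
Proof.
apply: (measurableT_comp (g := fun y : base F => (y, s)) (measurable_pt F)).
exact: pair2_measurable.
Qed.

(** Gives a section of the fibration landing inside the open cell, through which measurability and
    bounds pass from the cell to its base. *)
Definition slab_mid j : R := (node M d (j d) + node M d (j d).+1) / 2.

Lemma in_slab_mid j : in_slab j d (slab_mid j).
Proof. by have ab := node_lt_cell j d; apply/andP; rewrite !midf_lt. Qed.

Lemma cell_mid j y : base_set j y -> cell_set j (pt F (slab_mid j) y).
Proof. by move=> jy; apply/cell_pt; split => //; exact: in_slab_mid. Qed.

Lemma measurable_base_set j : measurable (base_set j).
Proof.
rewrite (_ : base_set j = setT `&` pt F (slab_mid j) @^-1` cell_set j).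
  exact: measurable_pt_at (measurable_cell j).
apply/seteqP; split => y; first by move=> /cell_mid.
by move=> [_ /cell_pt[]].
Qed.

(** In fibred coordinates the cell is the product of its base with a slab of positive length, and
    its measure is finite; an infinite base would make the product infinite. *)
Lemma base_measure_lty j : (nu (base_set j) < +oo)%E.
Proof.
have lebE : leb [set c | in_slab j d c] = (node M d (j d).+1 - node M d (j d))%:E.
  by rewrite in_slabE lebesgue_measure_itv/= lte_fin node_lt_cell -EFinB.
have := leb6_cell_lty j.
rewrite (leb6_pushforward F (measurable_cell j)) /pushforward.
rewrite (_ : _ @^-1` _ = base_set j `*` [set c | in_slab j d c]); last first.
  by apply/seteqP; split => -[y s] /cell_pt.
rewrite product_measure1E//; [|exact: measurable_base_set|by rewrite in_slabE].
rewrite [X in (_ * X)%E]lebE.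
have [//|] := ltP (nu (base_set j)) +oo%E; rewrite leye_eq => /eqP nuy.
by rewrite [X in (X * _)%E]nuy gt0_mulye ?ltxx// lte_fin subr_gt0 node_lt_cell.
Qed.

Lemma tame_zcoord_pt j s k : tame (base_set j) (fun y => zcoord (pt F s y) k).
Proof.
have [->|kd] := eqVneq k d.
  by under eq_fun do rewrite zcoord_pt; exact: tame_cst.
apply: (@tame_slab _ _ _ _ j k).
  exact: measurableT_comp (measurable_zcoord k) (measurable_pt_at s).
by move=> y jy; rewrite (zcoord_pt_neq _ 0)//; exact: jy.
Qed.

End Base.

Lemma tame_zcoord j k : tame (cell_set j) (fun z : phase R => zcoord z k).
Proof. by apply: (@tame_slab _ _ _ _ j k); [exact: measurable_zcoord|move=> z]. Qed.

End Cells.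

Arguments base_set {R M d} F j.
Arguments face_int_base {R M d} F j b g.

(** * Polynomials on lines and traces *)

Section PolynomialLines.
Variable R : realType.
Notation leb := (@lebesgue_measure R).

Lemma tame_deriv_line_poly dY (Y : measurableType dY) (D : set Y)
    (h : Y -> phase R) (p : mpoly.mpoly (3 + 3) R) d :
  (forall k, tame D (fun y => zcoord (h y) k)) ->
  tame D (fun y => (line_poly p (h y) d)^`().[zcoord (h y) d]).
Proof.
move=> th.
(* The product rule needs values as well as derivatives, so the induction over the construction of
   the polynomial carries both. *)
pose T (q : Y -> {poly R}) :=
  tame D (fun y => (q y).[zcoord (h y) d]) /\
  tame D (fun y => (q y)^`().[zcoord (h y) d]).
have TC (c : Y -> R) : tame D c -> T (fun y => (c y)%:P).
  move=> tc; split; first by under eq_fun do rewrite hornerC.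
  by under eq_fun do rewrite derivC horner0; exact: tame_cst.
have TX : T (fun=> 'X).
  split; first by under eq_fun do rewrite hornerX.
  by under eq_fun do rewrite derivX hornerC; exact: tame_cst.
have TM q r : T q -> T r -> T (fun y => q y * r y).
  move=> [tq tq'] [tr tr']; split.
    by under eq_fun do rewrite hornerM; exact: tameM.
  under eq_fun do rewrite derivM hornerD !hornerM.
  by apply: tameD; exact: tameM.
have TD q r : T q -> T r -> T (fun y => q y + r y).
  move=> [tq tq'] [tr tr']; split.
    by under eq_fun do rewrite hornerD; exact: tameD.
  by under eq_fun do rewrite derivD hornerD; exact: tameD.
suff [] : T (fun y => line_poly p (h y) d) by [].
rewrite /line_poly; elim: (mpoly.msupp p) => [|m s ih].
  under eq_fun do rewrite big_nil -polyC0.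
  exact/TC/tame_cst.
under eq_fun do rewrite big_cons.
apply: (TD _ _ _ ih) => {ih}; apply: (TM); first exact/TC/tame_cst.
elim: (index_enum _) => [|i r ih].
  under eq_fun do rewrite big_nil -polyC1.
  exact/TC/tame_cst.
under eq_fun do rewrite big_cons.
apply: (TM _ _ _ ih) => {ih}; elim: (m i) => [|n ih].
  under eq_fun do rewrite expr0 -polyC1.
  exact/TC/tame_cst.
under eq_fun do rewrite exprS.
by apply: (TM _ _ _ ih); case: (_ == d) => //; exact/TC/th.
Qed.

Lemma integral_deriv_poly (q : {poly R}) a b : a < b ->
  (\int[leb]_(s in `]a, b[) (q^`().[s])%:E = (q.[b] - q.[a])%:E)%E.
Proof.
move=> ab.
have mq (A : set R) : measurable_fun A (EFin \o horner q^`()).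
  by apply/measurable_EFinP; exact: measurable_poly.
rewrite integral_itv_bndo_bndc; last exact: mq.
rewrite integral_itv_obnd_cbnd; last exact: mq.
rewrite (@continuous_FTC2 _ _ (horner q))//.
- by apply: continuous_subspaceT => s; exact: continuous_horner.
- split.
  + by move=> s _; exact: derivable_horner.
  + by apply: cvg_at_right_filter; exact: continuous_horner.
  + by apply: cvg_at_left_filter; exact: continuous_horner.
- by move=> s _; rewrite -derivE.
Qed.

Variable M : mesh R.
Implicit Types (j : cell M) (d : dir).

Lemma cell_upd j z d c : (forall k, k != d -> in_slab j k (zcoord z k)) ->
  in_slab j d c -> cell_set j (upd z d c).
Proof. by move=> zj cj k; rewrite zcoord_upd; case: eqP => [->//|/eqP/zj]. Qed.

(** The cell is open, so [w] agrees with the polynomial near [z] on the line, and the two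
    derivatives coincide. *)
Lemma grad_cell j w p z d : (forall z, cell_set j z -> w z = peval p z) ->
  cell_set j z -> grad w z d = (line_poly p z d)^`().[zcoord z d].
Proof.
move=> wp zj; rewrite /grad.
(* Recentred at [z], because [grad] differentiates in the displacement at 0. *)
pose r := line_poly p z d \Po ('X + (zcoord z d)%:P).
transitivity ((horner r)^`()%classic 0).
  rewrite !derive1E; apply: near_eq_derive.
  have /andP[az zb] := zj d.
  have z0 : (0 : R) \in `]node M d (j d) - zcoord z d, node M d (j d).+1 - zcoord z d[.
    by rewrite in_itv/= subr_lt0 subr_gt0 az zb.
  apply: filterS (near_in_itvoo z0) => s; rewrite in_itv/= ltrBlDr ltrBrDr => sz.
  rewrite move_axis wp; last by apply: cell_upd => [k _|]; rewrite 1?addrC.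
  by rewrite -horner_line_poly horner_comp !hornerE addrC.
by rewrite -derivE deriv_comp hornerM horner_comp !hornerE derivD derivX derivC !hornerE.
Qed.

(** For small positive [s] the point lies in the open cell, where [f] is a polynomial in [s], hence
    continuous up to the face. Inner and outer traces are both brought to this form. *)
Lemma lim_trace j d b p (f : phase R -> R) z :
  (forall z, cell_set j z -> f z = peval p z) -> face_set j d b z ->
  lim (f (upd z d (zcoord z d - (-1) ^+ (~~ b) * s)) @[s --> (0 : R)^'+]) = peval p z.
Proof.
move=> fp [zd zk].
apply: cvg_lim => //.
rewrite -[in X in _ --> X](upd_id z d) -horner_line_poly.
apply: (@cvg_trans _
  ((line_poly p z d).[zcoord z d - (-1) ^+ (~~ b) * s] @[s --> (0 : R)^'+])).
  apply: near_eq_cvg; near=> s.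
  rewrite horner_line_poly fp//; apply: cell_upd => //; rewrite zd /face_pos.
  have s0 : 0 < s by near: s; exact: nbhs_right_gt.
  have sl : s < node M d (j d).+1 - node M d (j d).
    by near: s; apply: nbhs_right_lt; rewrite subr_gt0 node_lt_cell.
  rewrite /in_slab; case: (b) => /=.
    by rewrite expr0 mul1r addn1 ltrBrDr addrC -ltrBrDr sl ltrBlDr ltrDl s0.
  by rewrite expr1 mulN1r opprK addn0 ltrDl s0 addrC -ltrBrDr.
apply: cvg_at_right_filter.
rewrite [X in _ --> X](_ : _ = (line_poly p z d).[zcoord z d - (-1) ^+ (~~ b) * 0]).
  apply: (@continuous_comp _ _ _ (fun s : R => zcoord z d - (-1) ^+ (~~ b) * s)
    (horner (line_poly p z d))); last exact: continuous_horner.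
  by apply: cvgB; [exact: cvg_cst|apply: cvgM; [exact: cvg_cst|exact: cvg_id]].
by rewrite mulr0 subr0.
Unshelve. all: by end_near. Qed.

Lemma trace_in_face j d b p f z :
  (forall z, cell_set j z -> f z = peval p z) -> face_set j d b z ->
  trace_in d b f z = peval p z.
Proof.
move=> fp zf; rewrite -(lim_trace fp zf) /trace_in.
by under eq_fun do rewrite move_normal mulrN.
Qed.

End PolynomialLines.

(** * Integration by parts on a cell *)

Lemma tame_comp dX dY (X : measurableType dX) (Y : measurableType dY) (R : realType)
    (D : set X) (D' : set Y) (h : X -> Y) (g : Y -> R) :
  measurable D -> measurable D' -> measurable_fun setT h -> (forall x, D x -> D' (h x)) ->
  tame D' g -> tame D (fun x => g (h x)).
Proof.
move=> mD mD' mh DD' [mg [C gC]]; split.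
  apply: (measurable_comp mD' _ mg) => [_ [x Dx <-]|]; first exact: DD'.
  exact: measurable_funTS.
by exists C => x /DD'; exact: gC.
Qed.

Lemma tame_Rintegral_sum dX (X : measurableType dX) (R : realType)
    (mu : {measure set X -> \bar R}) (D : set X) (I : Type) (s : seq I)
    (g : I -> X -> R) :
  measurable D -> (mu D < +oo)%E -> (forall i, tame D (g i)) ->
  \int[mu]_(x in D) (\sum_(i <- s) g i x) = \sum_(i <- s) \int[mu]_(x in D) g i x.
Proof.
move=> mD Doo tg; elim: s => [|i s ih].
  by under eq_Rintegral do rewrite big_nil; rewrite big_nil Rintegral_cst// mul0r.
under eq_Rintegral do rewrite big_cons.
rewrite big_cons -ih RintegralD//; first exact: tame_integrable.
by apply: tame_integrable => //; exact: tame_sum.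
Qed.

Section Parts.
Variables (R : realType) (M : mesh R) (j : cell M) (d : dir) (F : fibration R d).
Notation nu := (base_measure F).
Notation leb := (@lebesgue_measure R).
Variable a : phase R -> R.
Hypothesis a_upd : forall z c, a (upd z d c) = a z.
Hypothesis tame_a : tame (cell_set j) a.

Lemma a_pt s s' y : a (pt F s y) = a (pt F s' y).
Proof. by rewrite -(upd_pt F s s') a_upd. Qed.

(** Control of [a] is assumed in the open cell only; as [a] is constant along lines, its values at
    any parameter, in particular on the faces, are those at the middle of the slab. *)
Lemma tame_base_a s : tame (base_set F j) (fun y => a (pt F s y)).
Proof.
apply: (@eq_tame _ _ _ _ (fun y => a (pt F (slab_mid d j) y))) => [y _|].
  exact: a_pt.
apply: (tame_comp (D' := cell_set j)) => //.
- exact: measurable_base_set.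
- exact: measurable_cell.
- exact: measurable_pt_at.
- exact: cell_mid.
Qed.

(** On each line [a] is constant, so the integrand is the derivative of half of [a] times the square
    of [w]. Fubini and the fundamental theorem of calculus leave the values at the two ends. *)
Lemma integral_cell_parts (w : phase R -> R) p :
  (forall z, cell_set j z -> w z = peval p z) ->
  \int[@leb6 R]_(z in cell_set j) (grad w z d * a z * w z) =
  \int[nu]_(y in base_set F j)
    (2^-1 * (a (pt F (face_pos j d true) y) * peval p (pt F (face_pos j d true) y) ^+ 2)
   - 2^-1 * (a (pt F (face_pos j d false) y) * peval p (pt F (face_pos j d false) y) ^+ 2)).
Proof.
move=> wp.
pose h z := (line_poly p z d)^`().[zcoord z d] * a z * peval p z.
have th : tame (cell_set j) h.
  apply: tameM; last by apply: tame_peval => k; exact: tame_zcoord.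
  apply: tameM => //.
  by apply: (@tame_deriv_line_poly _ _ _ _ (fun z => z)) => k; exact: tame_zcoord.
rewrite (@eq_Rintegral _ _ _ _ _ h); last first.
  by move=> z; rewrite inE => zj; rewrite /h (grad_cell d wp)// wp.
rewrite /Rintegral (fibre_integral F); [|exact: measurable_cell|]; last first.
  exact: (tame_integrable (measurable_cell j) (leb6_cell_lty j)).
rewrite [in RHS]integral_mkcond; congr fine; apply: eq_integral => y _.
(* A line whose base point is outside the base of the cell misses the cell and contributes zero. *)
rewrite patchE; case: ifPn => [|yj]; last first.
  rewrite integral0_eq// => s _; rewrite patchE ifF//.
  by apply: contraNF yj; rewrite !inE => /cell_pt[].
rewrite inE => yj.
rewrite (_ : (fun s => _) =
    (fun s => (h (pt F s y))%:E) \_ [set s | in_slab j d s]); last first.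
  apply/funext => s; rewrite !patchE; congr (if _ then _ else _).
  by apply/idP/idP; rewrite !inE; [case/cell_pt|move=> js; apply/cell_pt].
rewrite -integral_mkcond in_slabE.
pose q := line_poly p (pt F 0 y) d.
have lineE s : line_poly p (pt F s y) d = q by rewrite -(upd_pt F 0 s) line_poly_upd.
have pE s : peval p (pt F s y) = q.[s] by rewrite horner_line_poly upd_pt.
(* The primitive of the integrand on the line over [y]. *)
pose Q := (2^-1 * a (pt F 0 y)) *: q ^+ 2.
transitivity (\int[leb]_(s in `]node M d (j d), node M d (j d).+1[) (Q^`().[s])%:E)%E.
  apply: eq_integral => s _; rewrite /h lineE zcoord_pt pE (a_pt s 0) /Q.
  by rewrite derivZ expr2 derivM !hornerE; congr EFin; field.
apply: etrans (integral_deriv_poly Q (node_lt_cell j d)) _.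
rewrite /Q.
rewrite !pE !(a_pt _ 0) !hornerE /face_pos addn0 addn1.
by congr EFin; rewrite !mulrA.
Qed.

End Parts.

(** * Neighbouring cells *)

Section Neighbours.
Variables (R : realType) (M : mesh R) (per : bool).
Implicit Types (j : cell M) (d : dir) (b : bool).

(* The indices are cyclic, so a cell adjacent to the boundary of the mesh gets the
   neighbour it has in the periodic case. *)
Definition neighbour j d b : cell M :=
  [ffun k => if k == d then (if b then ordS (j k) else ord_pred (j k)) else j k].

Lemma neighbour_neq j d b k : k != d -> neighbour j d b k = j k.
Proof. by rewrite ffunE => /negPf ->. Qed.

Lemma neighbour_eq j d b :
  neighbour j d b d = if b then ordS (j d) else ord_pred (j d).
Proof. by rewrite ffunE eqxx. Qed.

Lemma neighbourK j d b : neighbour (neighbour j d b) d (~~ b) = j.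
Proof.
apply/ffunP => k; rewrite !ffunE; case: eqP => // _.
by case: b; rewrite (ordSK, ord_predK).
Qed.

(** Cyclic succession sends the last index to 0 and no other index there, so wrapping around occurs
    exactly at boundary faces, seen from either side. *)
Lemma on_boundary_neighbour j d b :
  on_boundary (neighbour j d b) d (~~ b) = on_boundary j d b.
Proof.
rewrite /on_boundary neighbour_eq; case: b => /=.
  have := ltn_ord (j d); rewrite leq_eqVlt => /predU1P[e|lt].
    by rewrite e modnn !eqxx.
  by rewrite modn_small// (ltn_eqF lt).
have := ltn_ord (j d); set n := ncell M d; case: (val (j d)) => [|i] lt /=.
  by rewrite add0n modn_small ?prednK ?eqxx//; exact: ncell_gt0.
by rewrite modnDr modn_small ?(ltn_eqF lt)// ltnW.
Qed.

Lemma on_wall_neighbour j d b :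
  on_wall per (neighbour j d b) d (~~ b) = on_wall per j d b.
Proof. by rewrite /on_wall /on_seam on_boundary_neighbour. Qed.

(** The shift that is inlined in [trace_out]. *)
Definition seam_period j d b : R :=
  if on_seam per j d b then node M d (ncell M d) - node M d 0 else 0.

Lemma face_pos_neighbour j d b : ~~ on_wall per j d b ->
  face_pos (neighbour j d b) d (~~ b) =
  face_pos j d b - (-1) ^+ (~~ b) * seam_period j d b.
Proof.
rewrite /on_wall negb_and negbK /seam_period => wall.
(* Away from the walls, a boundary face can only be a periodic seam. *)
have -> : on_seam per j d b = on_boundary j d b.
  by apply/idP/idP => [/and3P[]//|bd]; rewrite bd in wall.
rewrite /face_pos neighbour_eq /on_boundary {wall}; have := ltn_ord (j d).
case: b => /=.
  rewrite leq_eqVlt expr0 mul1r addn0 addn1 => /predU1P[e|lt].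
    by rewrite e eqxx modnn; ring.
  by rewrite modn_small// (ltn_eqF lt) subr0.
rewrite expr1 mulN1r opprK addn0 addn1.
case: (val (j d)) => [|i] lt /=.
  by rewrite add0n modn_small ?prednK//; ring.
by rewrite modnDr modn_small 1?ltnW// addr0.
Qed.

Lemma face_neighbour j d b z : face_set j d b z ->
  face_set (neighbour j d b) d (~~ b)
    (upd z d (face_pos (neighbour j d b) d (~~ b))).
Proof.
move=> [_ zj]; split; first by rewrite zcoord_upd eqxx.
move=> k kd; rewrite zcoord_upd (negPf kd) /in_slab neighbour_neq//.
exact: zj.
Qed.

(** Leaving the cell through the face, after the periodic shift, is approaching the opposite face of
    the neighbour from inside, so the outer trace is an inner trace of the neighbour. *)
Lemma trace_out_face j d b (p : mpoly.mpoly (3 + 3) R) f z :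
  ~~ on_wall per j d b ->
  (forall z, cell_set (neighbour j d b) z -> f z = peval p z) ->
  face_set j d b z ->
  trace_out per j d b f z = peval p (upd z d (face_pos (neighbour j d b) d (~~ b))).
Proof.
move=> wall fp zf.
rewrite -(lim_trace fp (face_neighbour zf)) /trace_out -/(seam_period j d b).
under eq_fun => s.
  (* The doubly negated [b] is the sign of the neighbour's normal, which is reversed. *)
  rewrite move_normal (_ : _ + _ = zcoord (upd z d
      (face_pos (neighbour j d b) d (~~ b))) d - (-1) ^+ (~~ ~~ b) * s); last first.
    rewrite zcoord_upd eqxx face_pos_neighbour// (zf.1).
    by case: b {wall fp zf} => /=; rewrite !expr0 !expr1; ring.
  over.
by under [in RHS]eq_fun do rewrite upd_upd.
Qed.

End Neighbours.

(** * Energy balance at a fixed time *)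

Section EnergyBalance.
Variables (R : realType) (M : mesh R) (per : bool).
Variables (a : phase R -> dir -> R) (f df : phase R -> R).
Variable p : cell M -> mpoly.mpoly (3 + 3) R.
Hypothesis a_upd : forall z d c, a (upd z d c) d = a z d.
Hypothesis tame_a : forall j d, tame (cell_set (M := M) j) (a ^~ d).
Hypothesis fp : forall j z, cell_set j z -> f z = peval (p j) z.
Hypothesis f_wall : vanishes_on_walls M per f.
Implicit Types (j : cell M) (d : dir) (b : bool).

(** Crossing the face, even with a periodic shift, changes only the coordinate [d], on which
    component [d] of [a] does not depend. Both traces of the normal component thus agree, and the
    maximum defining the penalty is their common absolute value. *)
Lemma LF_flux_face j d b z : ~~ on_wall per j d b -> face_set j d b z ->
  let v := peval (p (neighbour j d b)) (upd z d (face_pos (neighbour j d b) d (~~ b))) in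
  let u := peval (p j) z in
  LF_flux per j d b a f z =
  2^-1 * ((-1) ^+ (~~ b) * a z d * (v + u)) - `|a z d| / 2 * (v - u).
Proof.
move=> wall zf v u; rewrite /LF_flux (negPf wall) !dot_normal.
rewrite (trace_in_face (fp (j := j)) zf).
rewrite (trace_out_face wall (fp (j := neighbour j d b)) zf) -/v -/u.
have -> : trace_in d b (a^~ d) z = a z d.
  by rewrite /trace_in; under eq_fun do rewrite move_normal a_upd; exact: lim_cst.
have -> : trace_out per j d b (a^~ d) z = a z d.
  by rewrite /trace_out; under eq_fun do rewrite move_normal a_upd; exact: lim_cst.
by rewrite maxxx normrMsign -mulrDr.
Qed.

Section Faces.
Variables (d : dir) (F : fibration R d).
Local Notation nu := (base_measure F).
Local Notation base j := (base_set F j).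

(** Orientation sign, inner trace, outer trace and unsigned normal component, as functions on the
    base. The outer trace is the neighbour's inner trace over the same base point: a periodic shift
    stays on the line. *)
Let e b : R := (-1) ^+ (~~ b).
Let u j b y := peval (p j) (pt F (face_pos j d b) y).
Let v j b y := u (neighbour j d b) (~~ b) y.
Let A y := a (pt F 0 y) d.

(** The share of one face in the balance of the cell: the flux term minus the end term produced by
    integration by parts. It has no sign on its own; only matching pairs of faces do. *)
Definition face_loss j b : R :=
  face_int j d b (fun z => trace_in d b f z * LF_flux per j d b a f z)
  - (-1) ^+ (~~ b) * \int[nu]_(y in base_set F j)
      (2^-1 * (a (pt F (face_pos j d b) y) d * peval (p j) (pt F (face_pos j d b) y) ^+ 2)).

Let a_ptE s y : a (pt F s y) d = A y.
Proof. by rewrite /A -(upd_pt F s 0) a_upd. Qed.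

Let face_pt j b y : base j y -> face_set j d b (pt F (face_pos j d b) y).
Proof. by rewrite -(face_base F j b). Qed.

Let tame_u j j' b : tame (base j) (u j' b).
Proof. by apply: tame_peval => k; exact: tame_zcoord_pt. Qed.

Let tame_A j : tame (base j) A.
Proof.
by apply: (@tame_base_a _ _ _ _ _ (a ^~ d)) => //.
Qed.

(** The flux term vanishes by the definition of the flux on walls, the end term because the trace of
    [f] is zero there. *)
Lemma face_loss_wall j b : on_wall per j d b -> face_loss j b = 0.
Proof.
move=> wall; rewrite /face_loss (face_int_base F).
rewrite (@eq_Rintegral _ _ _ _ _ (fun=> 0)) ?Rintegral_cst ?mul0r; last 2 first.
- exact: measurable_base_set.
- by move=> y _; rewrite /LF_flux wall mulr0.
rewrite (@eq_Rintegral _ _ _ _ _ (fun=> 0)) ?Rintegral_cst ?mul0r ?mulr0 ?subr0//.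
  exact: measurable_base_set.
move=> y; rewrite inE => /(face_pt b) yf.
by rewrite -(trace_in_face (fp (j := j)) yf) (f_wall wall yf) expr0n !mulr0.
Qed.

Lemma face_lossE j b : ~~ on_wall per j d b ->
  face_loss j b = \int[nu]_(y in base j)
    (u j b y * (2^-1 * (e b * A y * (v j b y + u j b y)) - `|A y| / 2 * (v j b y - u j b y))
     - e b * (2^-1 * (A y * u j b y ^+ 2))).
Proof.
move=> wall; have mS := measurable_base_set F j.
have tu := tame_u j j b; have tv : tame (base j) (v j b) by exact: tame_u.
have tA := tame_A j.
have tc c : tame (base j) (fun=> c) by exact: tame_cst.
rewrite RintegralB//; last 2 first.
- apply: (tame_integrable mS (base_measure_lty F j)).
  apply: tameM => //; apply: tameB; apply: tameM => //.
    by apply: tameM; [exact: tameM|exact: tameD].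
    by apply: tameM => //; exact: tame_norm.
  exact: tameB.
- apply: (tame_integrable mS (base_measure_lty F j)).
  by do 3 apply: tameM => //; exact: tameX.
congr (_ - _).
  rewrite (face_int_base F); apply: eq_Rintegral => y; rewrite inE => yj.
  have yf := face_pt b yj.
  by rewrite (trace_in_face (fp (j := j)) yf) (LF_flux_face wall yf) a_ptE upd_pt.
rewrite -RintegralZl//; last first.
  apply: (tame_integrable mS (base_measure_lty F j)).
  apply: tameM => //; apply: tameM; last exact: tameX.
  by under eq_fun do rewrite a_ptE.
by apply: eq_Rintegral => y _; rewrite a_ptE.
Qed.

Lemma base_neighbour j b : base (neighbour j d b) = base j.
Proof.
apply/seteqP; split => y yj k kd; have := yj k kd;
  by rewrite /in_slab neighbour_neq.
Qed.

(** These are the two sides of one interior or periodic face, over a common base. The central fluxes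
    cancel against the end terms and the penalty leaves a square. If the face is a wall, so is the
    one paired with it cyclically, and both losses are zero. *)
Lemma face_loss_pair j :
  0 <= face_loss j true + face_loss (neighbour j d true) false.
Proof.
have [wall|wall] := boolP (on_wall per j d true).
  by rewrite !face_loss_wall ?addr0// (on_wall_neighbour per j d true).
have wall' : ~~ on_wall per (neighbour j d true) d false.
  by rewrite (on_wall_neighbour per j d true).
rewrite !face_lossE// base_neighbour /v (neighbourK j d true).
set j' := neighbour j d true.
have mS := measurable_base_set F j.
have tc c : tame (base j) (fun=> c) by exact: tame_cst.
have tAj := tame_A j.
have tK b w w' : tame (base j) w -> tame (base j) w' ->
    tame (base j) (fun y => w y * (2^-1 * (e b * A y * (w' y + w y)) -
      `|A y| / 2 * (w' y - w y)) - e b * (2^-1 * (A y * w y ^+ 2))).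
  move=> tw tw'; apply: tameB; apply: tameM => //.
    apply: tameB; apply: tameM => //.
      by apply: tameM; [exact: tameM|exact: tameD].
      by apply: tameM => //; exact: tame_norm.
    exact: tameB.
  by do 2 apply: tameM => //; exact: tameX.
rewrite -RintegralD//; first last.
- by apply: (tame_integrable mS (base_measure_lty F j)); apply: tK; exact: tame_u.
- by apply: (tame_integrable mS (base_measure_lty F j)); apply: tK; exact: tame_u.
apply: Rintegral_ge0 => y _; rewrite /e/= expr0 expr1.
rewrite [leRHS](_ : _ = 2^-1 * `|A y| * (u j true y - u j' false y) ^+ 2).
  by rewrite mulr_ge0 ?sqr_ge0// mulr_ge0 ?invr_ge0.
by field.
Qed.

Lemma sum_face_loss : 0 <= \sum_j (face_loss j true + face_loss j false).
Proof.
rewrite big_split/=.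
(* The cyclic shift of cells is a bijection, so each lower face can be counted with the upper face
   it matches. *)
rewrite [X in _ + X](reindex (fun j => neighbour j d true)) /=; last first.
  exists (fun j => neighbour j d false) => j _; first exact: (neighbourK j d true).
  exact: (neighbourK j d false).
by rewrite -big_split; apply: sumr_ge0 => j _; exact: face_loss_pair.
Qed.

End Faces.

Hypothesis scheme : forall j, DG_scheme per j a f df f.

(** The scheme tested with [f] itself: the volume term is split by axes, and each part is integrated
    along the fibration of its own axis. *)
Lemma cell_balance j : \int[@leb6 R]_(z in cell_set j) (f z * df z) =
  - \sum_d (face_loss (axis_fibration R d) j true + face_loss (axis_fibration R d) j false).
Proof.
have mC := measurable_cell j; have Coo := leb6_cell_lty j.
have := scheme j; rewrite /DG_scheme.
have -> : \int[@leb6 R]_(z in cell_set j) (dot (grad f z) (a z) * f z) =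
    \sum_d \int[@leb6 R]_(z in cell_set j) (grad f z d * a z d * f z).
  rewrite -tame_Rintegral_sum//.
    by apply: eq_Rintegral => z _; rewrite mulr_suml.
  move=> d.
  apply: (@eq_tame _ _ _ _
    (fun z => (line_poly (p j) z d)^`().[zcoord z d] * a z d * peval (p j) z)).
    by move=> z jz; rewrite (grad_cell d (fp (j := j)))// (fp jz).
  apply: tameM; last by apply: tame_peval => k; exact: tame_zcoord.
  apply: tameM => //.
  by apply: (@tame_deriv_line_poly _ _ _ _ (fun z => z)) => k; exact: tame_zcoord.
move=> /eqP; rewrite -addrA addr_eq0 => /eqP ->; congr (- _).
rewrite -sumrB; apply: eq_bigr => d _.
rewrite (integral_cell_parts (axis_fibration R d) (a_upd ^~ d) (tame_a j d) (fp (j := j))).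
have tame_face b : tame (base_set (axis_fibration R d) j) (fun y =>
    2^-1 * (a (pt (axis_fibration R d) (face_pos j d b) y) d *
      peval (p j) (pt (axis_fibration R d) (face_pos j d b) y) ^+ 2)).
  apply: tameM; first exact: tame_cst.
  apply: tameM.
    exact: (tame_base_a (axis_fibration R d) (a_upd ^~ d) (tame_a j d)).
  by apply: tameX; apply: tame_peval => k; exact: tame_zcoord_pt.
have int_face b := tame_integrable (measurable_base_set (axis_fibration R d) j)
  (base_measure_lty (axis_fibration R d) j) (tame_face b).
rewrite RintegralB; [|exact: measurable_base_set|exact: int_face|exact: int_face].
rewrite big_bool /face_loss/= expr0 expr1 mul1r mulN1r opprK opprB.
by rewrite [X in _ + X = _]addrC addrACA.
Qed.

Lemma energy_loss : \sum_(j : cell M) \int[@leb6 R]_(z in cell_set j) (f z * df z) <= 0.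
Proof.
under eq_bigr do rewrite cell_balance.
rewrite sumrN oppr_le0 exchange_big/=; apply: sumr_ge0 => d _.
exact: sum_face_loss.
Qed.

End EnergyBalance.

(** * The phase-space velocity of the Vlasov equation *)

Section Alpha.
Variables (R : realType) (M : mesh R) (q m : R) (E B : space3 R -> 'I_3 -> R).

(** The velocity does not involve the position, the fields do not involve the velocity, and
    component [i] of a cross product with [v] contains only the other two components of [v]. *)
Lemma alpha_upd z d c : alpha q m E B (upd z d c) d = alpha q m E B z d.
Proof.
case: d => i; first exact: (zcoord_upd z (inl i) c (inr i)).
set z' := upd z (inr i) c.
have xE : z'.1 = z.1.
  by apply: coord3_inj => k; exact: (zcoord_upd z (inr i) c (inl k)).
have vE (k : 'I_3) : k != i -> coord3 z'.2 k = coord3 z.2 k.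
  move=> ki; have := zcoord_upd z (inr i) c (inr k).
  by rewrite (_ : (inr k == inr i :> dir) = false)//; exact: negbTE.
transitivity (q / m * (E z'.1 i + cross (coord3 z'.2) (B z'.1) i)) => //.
by rewrite xE /cross !vE//; elim/ord3P: i {z' xE vE}.
Qed.

Hypothesis hE : forall i, piecewise_poly M (fun x => E x i).
Hypothesis hB : forall i, piecewise_poly M (fun x => B x i).

Lemma tame_field (g : space3 R -> R) (j : cell M) : piecewise_poly M g ->
  tame (cell_set j) (fun z => g z.1).
Proof.
move=> /(_ j)[p gp]; apply: (@eq_tame _ _ _ _ (fun z => peval3 p z.1)).
  by move=> z zj; rewrite gp// => i; exact: (zj (inl i)).
by apply: tame_meval => i; exact: (tame_zcoord j (inl i)).
Qed.

Lemma tame_alpha (j : cell M) d : tame (cell_set j) (alpha q m E B ^~ d).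
Proof.
case: d => i /=; first exact: (tame_zcoord j (inr i)).
apply: tameM; first exact: tame_cst.
apply: tameD; first exact: tame_field (hE i).
by apply: tameB; apply: tameM;
  [exact: (tame_zcoord j (inr _))|exact: (tame_field _ (hB _))
  |exact: (tame_zcoord j (inr _))|exact: (tame_field _ (hB _))].
Qed.

End Alpha.

(** * Time derivative of the energy *)

(* Points are added one at a time: as long as some basis element differs from its
   interpolant, a point where they differ extends the interpolation scheme. *)
Lemma finite_interpolation (K : fieldType) (X : Type) (W : lmodType K)
    (ev : X -> {scalar W}) (l : seq W) :
  exists s : seq (X * W), forall w, w \in l ->
    forall x, ev x w = \sum_(y <- s) ev y.1 w * ev x y.2.
Proof.
elim: l => [|w0 l [s IH]]; first by exists [::].
(* The interpolant of [w] for the scheme found so far. *)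
pose L w := \sum_(y <- s) ev y.1 w *: y.2.
have LE x w : ev x (L w) = \sum_(y <- s) ev y.1 w * ev x y.2.
  by rewrite linear_sum; apply: eq_bigr => y _; rewrite linearZ.
have [w0L|] := pselect (forall x, ev x w0 = ev x (L w0)).
  by exists s => w; rewrite inE => /predU1P[->|/IH//] x; rewrite w0L LE.
move=> /existsNP[x0 /eqP x0P].
pose r := w0 - L w0; pose c := ev x0 r.
have c0 : c != 0 by rewrite /c linearB subr_eq0.
(* The residual [r], normalized to 1 at [x0], is the new weight; the old weights are corrected to
   vanish at [x0]. The new interpolant is [L w] plus the error of [L w] at [x0] times that weight:
   this error is zero for old elements and restores [r] for [w0]. *)
exists ((x0, c^-1 *: r) :: [seq (y.1, y.2 - (ev x0 y.2 * c^-1) *: r) | y <- s]).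
move=> w wl x; rewrite big_cons big_map/= linearZ/=.
under eq_bigr do rewrite linearB linearZ/= mulrBr.
rewrite sumrB -LE.
have -> : \sum_(y <- s) ev y.1 w * (ev x0 y.2 * c^-1 * ev x r) =
    ev x0 (L w) * (c^-1 * ev x r).
  by rewrite LE mulr_suml; apply: eq_bigr => y _; rewrite !mulrA.
move: wl; rewrite inE => /predU1P[->|wl]; last first.
  have wL y : ev y (L w) = ev y w by rewrite LE -IH.
  by rewrite !wL addrCA subrr addr0.
rewrite addrCA -mulrBl -[ev x0 w0 - _]linearB -/r -/c mulrA divff// mul1r.
by rewrite -linearD /r addrC subrK.
Qed.

Lemma is_derive_sum_seq (R : realType) (I : Type) (s : seq I) (g : I -> R -> R)
    (dg : I -> R) (t : R) :
  (forall i, is_derive t 1 (g i) (dg i)) ->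
  is_derive t 1 (fun r => \sum_(i <- s) g i r) (\sum_(i <- s) dg i).
Proof.
move=> gd; elim: s => [|i s ih].
  by under eq_fun do rewrite big_nil; rewrite big_nil; exact: is_derive_cst.
by under eq_fun do rewrite big_cons; rewrite big_cons; exact: is_deriveD.
Qed.

(** Interpolation on the spanning family extends by linearity. Points and weights are chosen before
    [w], so the same ones serve at all times. *)
Lemma DGspace_interpolation (R : realType) (M : mesh R)
    (P : set (mpoly.mpoly (3 + 3) R)) (j : cell M) :
  finite_dim_subspace P ->
  exists s : seq ({z | cell_set j z} * mpoly.mpoly (3 + 3) R),
    forall w, DGspace M P w -> forall z, cell_set j z ->
      w z = \sum_(y <- s) w (sval y.1) * peval y.2 z.
Proof.
move=> [N [phi ->]].
pose ev (x : {z | cell_set j z}) : {scalar mpoly.mpoly (3 + 3) R} :=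
  mpoly.meval (fun k => zcoord (sval x) (fintype.split k)).
have [s hs] := finite_interpolation ev [seq phi i | i <- enum 'I_N].
exists s => w /(_ j)[_ [c ->] wE] z zj.
have pE (x : {z | cell_set j z}) : w (sval x) = \sum_i c i * ev x (phi i).
  rewrite wE; last exact: svalP.
  by rewrite /peval [LHS](linear_sum (ev x)); apply: eq_bigr => i _; rewrite linearZ.
rewrite [LHS](pE (exist _ z zj)).
under eq_bigr => i _.
  rewrite hs; last by apply: map_f; rewrite mem_enum.
  over.
under [RHS]eq_bigr do rewrite pE mulr_suml.
rewrite [RHS]exchange_big/=; apply: eq_bigr => i _.
by rewrite mulr_sumr; apply: eq_bigr => y _; rewrite mulrA.
Qed.

Section TimeDerivative.
Variables (R : realType) (M : mesh R) (P : set (mpoly.mpoly (3 + 3) R)).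
Hypothesis hP : finite_dim_subspace P.
Variables (T : set R) (f : R -> phase R -> R).
Hypothesis hT : open T.
Hypothesis hf : forall t, T t -> DGspace M P (f t).
Hypothesis hdf : forall t, T t -> forall (j : cell M) z, cell_set j z ->
  derivable (fun s => f s z) t 1.

(** By interpolation the energy of the cell is a quadratic form, with constant coefficients, in
    finitely many point values of [f]; differentiation under the integral reduces to the product
    rule. *)
Lemma is_derive_cell_energy (j : cell M) t : T t ->
  is_derive t 1 (fun r => \int[@leb6 R]_(z in cell_set j) (f r z) ^+ 2)
    (2 * \int[@leb6 R]_(z in cell_set j) (f t z * derive1 (fun r => f r z) t)).
Proof.
move=> Tt; have [s fs] := DGspace_interpolation j hP.
have mC := measurable_cell j; have Coo := leb6_cell_lty j.
(* The Gram matrix of the interpolation weights. *)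
pose I2 (x y : {z | cell_set j z} * mpoly.mpoly (3 + 3) R) :=
  \int[@leb6 R]_(z in cell_set j) (peval x.2 z * peval y.2 z).
have I2C x y : I2 x y = I2 y x by apply: eq_Rintegral => z _; rewrite mulrC.
have tp q : tame (cell_set j) (peval q).
  by apply: tame_peval => k; exact: tame_zcoord.
have tpp c (x y : {z | cell_set j z} * mpoly.mpoly (3 + 3) R) :
    tame (cell_set j) (fun z => c * (peval x.2 z * peval y.2 z)).
  by apply: tameM; [exact: tame_cst|exact: tameM].
have bilin (b c : {z | cell_set j z} -> R) :
    \int[@leb6 R]_(z in cell_set j)
      ((\sum_(x <- s) b x.1 * peval x.2 z) * (\sum_(y <- s) c y.1 * peval y.2 z)) =
    \sum_(x <- s) \sum_(y <- s) b x.1 * c y.1 * I2 x y.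
  transitivity (\int[@leb6 R]_(z in cell_set j)
      (\sum_(x <- s) \sum_(y <- s) b x.1 * c y.1 * (peval x.2 z * peval y.2 z))).
    apply: eq_Rintegral => z _; rewrite mulr_suml; apply: eq_bigr => x _.
    by rewrite mulr_sumr; apply: eq_bigr => y _; rewrite mulrACA.
  rewrite tame_Rintegral_sum//; last by move=> x; exact: tame_sum.
  apply: eq_bigr => x _; rewrite tame_Rintegral_sum//; apply: eq_bigr => y _.
  by rewrite RintegralZl//; apply: tame_integrable => //; exact: tameM.
pose v r (x : {z | cell_set j z}) := f r (sval x).
pose dv (x : {z | cell_set j z}) := derive1 (v^~ x) t.
have dvP x : is_derive t 1 (v^~ x) (dv x).
  apply: DeriveDef; last by rewrite /dv derive1E.
  by apply: (hdf Tt (j := j)); exact: svalP.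
(* The interpolation formula is available only at times in [T]; openness makes it hold throughout a
   neighbourhood of [t], as differentiation requires. *)
have nearT : \forall r \near t, T r by exact: open_nbhs_nbhs.
have df z : cell_set j z ->
    derive1 (fun r => f r z) t = \sum_(y <- s) dv y.1 * peval y.2 z.
  move=> zj; rewrite derive1E.
  have D : is_derive t 1 (fun r => \sum_(y <- s) v r y.1 * peval y.2 z)
      (\sum_(y <- s) dv y.1 * peval y.2 z).
    apply: is_derive_sum_seq => y.
    apply: is_derive_eq.
    by rewrite scaler0 add0r /GRing.scale/= mulrC.
  rewrite -[RHS](@derive_val _ _ _ _ _ _ _ D); apply: near_eq_derive.
  by apply: filterS nearT => r Tr; exact: fs (hf Tr) _ zj.
(* The factor 2 is split over the two orders of summation, by symmetry of [I2], to match the product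
   rule. *)
have -> : 2 * \int[@leb6 R]_(z in cell_set j) (f t z * derive1 (fun r => f r z) t) =
    \sum_(x <- s) \sum_(y <- s) (v t x.1 * dv y.1 + v t y.1 * dv x.1) * I2 x y.
  rewrite (@eq_Rintegral _ _ _ _ _ (fun z => (\sum_(x <- s) v t x.1 * peval x.2 z) *
    (\sum_(y <- s) dv y.1 * peval y.2 z))); last first.
    by move=> z; rewrite inE => zj; rewrite df// (fs _ (hf Tt) _ zj).
  rewrite bilin mulr_natl mulr2n [X in _ + X]exchange_big/= -big_split/=.
  apply: eq_bigr => x _; rewrite -big_split/=; apply: eq_bigr => y _.
  by rewrite (I2C y x) mulrDl.
apply: (@near_eq_is_derive _ _ _
    (fun r => \sum_(x <- s) \sum_(y <- s) v r x.1 * v r y.1 * I2 x y)).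
  apply: filterS nearT => r Tr; rewrite -bilin; apply: eq_Rintegral => z.
  by rewrite inE => zj; rewrite (fs _ (hf Tr) _ zj) expr2.
apply: is_derive_sum_seq => x; apply: is_derive_sum_seq => y.
apply: is_derive_eq.
by rewrite scaler0 add0r /GRing.scale/= mulrC.
Qed.

End TimeDerivative.

Theorem proposition7 (R : realType) (M : mesh R) (per : bool)
  (P : set (mpoly.mpoly (3 + 3) R))
  (hP : finite_dim_subspace P) (hP1 : P 1)
  (q m : R) (hm : 0 < m)
  (T : set R) (hT : open T)
  (E B : R -> space3 R -> 'I_3 -> R)
  (hE : forall t, T t -> forall i, piecewise_poly M (fun x => E t x i))
  (hB : forall t, T t -> forall i, piecewise_poly M (fun x => B t x i))
  (f : R -> phase R -> R)
  (hf : forall t, T t -> DGspace M P (f t))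
  (hdf : forall t, T t -> forall (j : cell M) z, cell_set j z ->
    derivable (fun s => f s z) t 1)
  (hscheme : forall t, T t -> forall (j : cell M) w, DGspace M P w ->
    DG_scheme per j (alpha q m (E t) (B t))
      (f t) (fun z => derive1 (fun s => f s z) t) w)
  (hwall : forall t, T t -> vanishes_on_walls M per (f t)) :
  forall t, T t ->
    let energy s := \sum_(j : cell M) \int[@leb6 R]_(z in cell_set j) (f s z) ^+ 2 in
    derivable energy t 1 /\ derive1 energy t <= 0.
Proof.
move=> t Tt energy.
have dE : is_derive t 1 energy (\sum_(j : cell M)
    2 * \int[@leb6 R]_(z in cell_set j) (f t z * derive1 (fun r => f r z) t)).
  by apply: is_derive_sum_seq => j; exact: (is_derive_cell_energy hP hT hf hdf).
split; first exact: ex_derive.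
rewrite derive1E derive_val -mulr_sumr pmulr_rle0//.
have [p fp] : exists p : cell M -> mpoly.mpoly (3 + 3) R,
    forall j z, cell_set j z -> f t z = peval (p j) z.
  have /choice[p fp] : forall j : cell M, exists p,
      forall z, cell_set j z -> f t z = peval p z.
    by move=> j; have [p _ fp] := hf t Tt j; exists p.
  by exists p.
apply: (energy_loss (per := per) (p := p) (a := alpha q m (E t) (B t))) => //.
- by move=> z d c; exact: alpha_upd.
- by move=> j d; apply: tame_alpha; [exact: hE|exact: hB].
- exact: hwall.
(* At each time [f t] lies in the discrete space, so it is an admissible test function. *)
- by move=> j; exact/hscheme/hf.
Qed.
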